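(* Let $\epsilon$ be a positive integer. Let $G=\langle\alpha,\beta\rangle$ be the group of bijections of $\mathbb{Q}_+^5$ generated by $$\alpha(a,b,c,d,e)=\Big(b,\tfrac{b^2+cd}{a},c,d,e\Big),\qquad \beta(a,b,c,d,e)=\Big(b,c,\tfrac{ac+be}{d},a,e\Big).$$ Let $$T(a,b,c,d,e)=\frac{ab(c^2+d^2+e^2)+(a^2+b^2+cd)(c+d)e}{abcd}-9,$$ and let $\varphi:\mathbb{Q}_+^5\to\mathbb{Q}_+^3$ be $$\varphi(a,b,c,d,e)=\Big(\frac{a^2+b^2+cd}{ab},\ \frac{c^2d+a^2c+b^2d+abe}{bcd},\ \frac{cd^2+a^2c+b^2d+abe}{acd}\Big).$$ Then a positive integer solution $P=(a,b,c,d,\epsilon)\in\mathbb{N}^5$ of $T(a,b,c,d,\epsilon)=0$ lies in the orbit $G(\epsilon,\epsilon,\epsilon,\epsilon,\epsilon)$ if and only if $\varphi(P)\in\mathbb{N}^3$ and $P\equiv 0\pmod{\epsilon}$. That is, $$G(\epsilon,\epsilon,\epsilon,\epsilon,\epsilon)=\{P=(a,b,c,d,\epsilon)\in\mathbb{N}^5\mid T(P)=0,\ \varphi(P)\in\mathbb{N}^3,\ P\equiv 0\pmod{\epsilon}\}.$$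
   Context: $\mathbb{N}$ denotes the positive integers and $\mathbb{Q}_+$ the positive rationals. $G(x)=\{g(x)\mid g\in G\}$ denotes the orbit. For a vector $P$, $P\equiv 0\pmod{\epsilon}$ means every component of $P$ is divisible by $\epsilon$. *)

(* Defs.v *)
From mathcomp Require Import all_boot all_order all_algebra.
From mathcomp Require Import interval_inference.
From mathcomp Require Import boolp classical_sets.

Set Implicit Arguments.
Unset Strict Implicit.
Unset Printing Implicit Defensive.
Import Order.TTheory GRing.Theory Num.Theory.
Local Open Scope classical_set_scope.
Local Open Scope ring_scope.

Notation Npos := {n : nat | (0 < n)%N}.
Notation Qpos := {posnum rat}.
Notation Qpos3 := (Qpos * Qpos * Qpos)%type.
Notation Qpos5 := (Qpos * Qpos * Qpos * Qpos * Qpos)%type.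

(* The subgroup generated by S inside the group of bijections of X, for S a
   set of bijections (see [generated_bij]); bijections are represented by their
   underlying functions. *)
Inductive generated (X : Type) (S : set (X -> X)) : set (X -> X) :=
| generated_mem f : S f -> generated S f
| generated_id : generated S idfun
| generated_comp f g : generated S f -> generated S g -> generated S (f \o g)
| generated_inv f g :
    generated S f -> cancel f g -> cancel g f -> generated S g.

Lemma generated_bij (X : Type) (S : set (X -> X)) :
  (forall f, S f -> bijective f) -> forall f, generated S f -> bijective f.
Proof.
move=> Sbij f; elim=> {f} [f /Sbij//||f g _ fbij _ gbij|f g _ _ fK gK].
- by exists idfun.
- exact: bij_comp.
- by exists f.
Qed.

Definition orbit_set (X : Type) (G : set (X -> X)) (x : X) : set X :=
  [set g x | g in G].

Definition alpha (P : Qpos5) : Qpos5 :=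
  let: (a, b, c, d, e) := P in
  (b, ((b%:num ^+ 2 + c%:num * d%:num) / a%:num)%:pos, c, d, e).

Definition beta (P : Qpos5) : Qpos5 :=
  let: (a, b, c, d, e) := P in
  (b, c, ((a%:num * c%:num + b%:num * e%:num) / d%:num)%:pos, a, e).

Lemma alpha_bij : bijective alpha.
Proof.
exists (fun P : Qpos5 => let: (a, b, c, d, e) := P in
  (((a%:num ^+ 2 + c%:num * d%:num) / b%:num)%:pos, a, c, d, e)).
- move=> [[[[a b] c] d] e]; rewrite /alpha; congr (_, _, _, _, _).
  apply/val_inj => /=; rewrite invf_div mulrC mulfVK //.
- move=> [[[[a b] c] d] e]; rewrite /alpha; congr (_, _, _, _, _).
  apply/val_inj => /=; rewrite invf_div mulrC mulfVK //.
Qed.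

Lemma beta_bij : bijective beta.
Proof.
exists (fun P : Qpos5 => let: (a, b, c, d, e) := P in
  (d, a, b, ((d%:num * b%:num + a%:num * e%:num) / c%:num)%:pos, e)).
- move=> [[[[a b] c] d] e]; rewrite /beta; congr (_, _, _, _, _).
  apply/val_inj => /=; rewrite invf_div mulrC mulfVK //.
- move=> [[[[a b] c] d] e]; rewrite /beta; congr (_, _, _, _, _).
  apply/val_inj => /=; rewrite invf_div mulrC mulfVK //.
Qed.

Definition G : set (Qpos5 -> Qpos5) := generated [set alpha; beta].

Lemma G_bij f : G f -> bijective f.
Proof.
by apply: generated_bij => {}f [] ->; [exact: alpha_bij|exact: beta_bij].
Qed.

Definition T (P : Qpos5) : rat :=
  let: (a, b, c, d, e) := P in
  let: (a, b, c, d, e) := (a%:num, b%:num, c%:num, d%:num, e%:num) in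
  (a * b * (c ^+ 2 + d ^+ 2 + e ^+ 2) + (a ^+ 2 + b ^+ 2 + c * d) * (c + d) * e)
    / (a * b * c * d) - 9.

Definition phi (P : Qpos5) : Qpos3 :=
  let: (a, b, c, d, e) := P in
  (((a%:num ^+ 2 + b%:num ^+ 2 + c%:num * d%:num) / (a%:num * b%:num))%:pos,
   ((c%:num ^+ 2 * d%:num + a%:num ^+ 2 * c%:num + b%:num ^+ 2 * d%:num
      + a%:num * b%:num * e%:num) / (b%:num * c%:num * d%:num))%:pos,
   ((c%:num * d%:num ^+ 2 + a%:num ^+ 2 * c%:num + b%:num ^+ 2 * d%:num
      + a%:num * b%:num * e%:num) / (a%:num * c%:num * d%:num))%:pos).

Lemma natQ_gt0 (n : Npos) : 0 < (val n)%:R :> rat.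
Proof. by rewrite ltr0n (valP n). Qed.

Definition natQ (n : Npos) : Qpos := PosNum (natQ_gt0 n).

Definition vecQ (a b c d e : Npos) : Qpos5 :=
  (natQ a, natQ b, natQ c, natQ d, natQ e).

(* N^3 as a subset of Q_+^3. *)
Definition N3 : set Qpos3 :=
  [set u | exists x y z : Npos, u = (natQ x, natQ y, natQ z)].

(* (a, b, c, d, e) = 0 mod m *)
Definition vec_dvd (m a b c d e : Npos) : bool :=
  [&& val m %| val a, val m %| val b, val m %| val c, val m %| val d
    & val m %| val e]%N.

(* Main.v *)
(** The coordinates (x, y, z) of [phi] behave like the traces of a torus with
    one boundary component: T = x y z - x^2 - y^2 - z^2 - 7, [beta] permutes
    them cyclically, and [alpha] sends (x, y, z) to (x, z, x z - y). Moreover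
    [alpha] and [beta] are linear in (a, b, c, d) with coefficients polynomial
    in the traces, so integral traces and divisibility by [eps] are preserved
    along the orbit. Conversely, Vieta descent on x y z = x^2 + y^2 + z^2 + 7
    moves any such point to the fibre over (3, 4, 4). There e is a linear form
    in (a, b, c), so a and b are determined by c and d, which in units of
    [eps] satisfy c^2 + d^2 - 9 c d + 3 (c + d) + 1 = 0 and c = d mod 4.
    The map [beta]^3 fixes the traces and performs the Vieta jump
    (c, d) -> (9 c - d - 3, c), so a second descent ends at c = d = [eps]. *)

Require Import Defs.
From mathcomp Require Import all_boot all_order all_algebra.
From mathcomp Require Import interval_inference.
From mathcomp Require Import boolp classical_sets.
From mathcomp Require Import ring lra zify.

Set Implicit Arguments.
Unset Strict Implicit.
Unset Printing Implicit Defensive.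
Import Order.TTheory GRing.Theory Num.Theory.
Local Open Scope classical_set_scope.
Local Open Scope ring_scope.

(** * Traces under the generators *)

Definition trace1 (P : Qpos5) : rat := (phi P).1.1%:num.
Definition trace2 (P : Qpos5) : rat := (phi P).1.2%:num.
Definition trace3 (P : Qpos5) : rat := (phi P).2%:num.

Lemma trace_alpha P :
  [/\ trace1 (alpha P) = trace1 P, trace2 (alpha P) = trace3 P &
      trace3 (alpha P) = trace1 P * trace3 P - trace2 P].
Proof.
case: P => [[[[a b] c] d] e]; rewrite /trace1 /trace2 /trace3 /=.
by split; field; rewrite ?gt_eqF.
Qed.

Lemma phi_beta P : phi (beta P) = ((phi P).1.2, (phi P).2, (phi P).1.1).
Proof.
case: P => [[[[a b] c] d] e] /=.
by congr (_, _, _); apply/val_inj => /=; field; rewrite ?gt_eqF.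
Qed.

Lemma trace_beta P :
  [/\ trace1 (beta P) = trace2 P, trace2 (beta P) = trace3 P &
      trace3 (beta P) = trace1 P].
Proof. by rewrite /trace1 /trace2 /trace3 phi_beta. Qed.

Lemma T_trace P : T P = trace1 P * trace2 P * trace3 P
  - trace1 P ^+ 2 - trace2 P ^+ 2 - trace3 P ^+ 2 - 7.
Proof.
case: P => [[[[a b] c] d] e]; rewrite /trace1 /trace2 /trace3 /T /=.
by field; rewrite ?gt_eqF.
Qed.

(* On a fixed fibre of [phi] the generators act linearly, which is why
   integrality survives the divisions in [alpha] and [beta]. *)
Lemma alpha_linear (a b c d e : Qpos) (P := (a, b, c, d, e) : Qpos5) :
  alpha P = (b, (alpha P).1.1.1.2, c, d, e)
  /\ (alpha P).1.1.1.2%:num = trace1 P * b%:num - a%:num.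
Proof. by split=> //; rewrite /trace1 /=; field; rewrite ?gt_eqF. Qed.

Lemma beta_linear (a b c d e : Qpos) (P := (a, b, c, d, e) : Qpos5) :
  beta P = (b, c, (beta P).1.1.2, a, e)
  /\ (beta P).1.1.2%:num = a%:num - trace1 P * b%:num + trace3 P * c%:num.
Proof. by split=> //; rewrite /trace1 /trace3 /=; field; rewrite ?gt_eqF. Qed.

(** These relations recover [d] and [e] linearly from [a], [b], [c] once the traces are known. *)
Lemma trace_relations (a b c d e : Qpos) (P := (a, b, c, d, e) : Qpos5) :
  trace3 P * a%:num + c%:num = trace2 P * b%:num + d%:num
  /\ (trace1 P * trace2 P - trace3 P) * b%:num
       - trace2 P * a%:num - trace1 P * c%:num = e%:num.
Proof. by split; rewrite /trace1 /trace2 /trace3 /=; field; rewrite ?gt_eqF. Qed.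

(** * Invariance of divisible solutions under [G] *)

(** Divisibility is integrality of the quotients by [k], to which the linear formulas apply
    directly; [Qpos] carries positivity. *)
Definition divisible_solution (k : Qpos) (P : Qpos5) : Prop :=
  let: (a, b, c, d, e) := P in
  [/\ e = k,
      [/\ a%:num / k%:num \is a Num.int, b%:num / k%:num \is a Num.int,
          c%:num / k%:num \is a Num.int & d%:num / k%:num \is a Num.int],
      [/\ trace1 P \is a Num.int, trace2 P \is a Num.int
        & trace3 P \is a Num.int] & T P = 0].

Lemma divisible_solutionE k a b c d e (P := (a, b, c, d, e) : Qpos5) :
  divisible_solution k P = [/\ e = k,
      [/\ a%:num / k%:num \is a Num.int, b%:num / k%:num \is a Num.int,
          c%:num / k%:num \is a Num.int & d%:num / k%:num \is a Num.int],
      [/\ trace1 P \is a Num.int, trace2 P \is a Num.int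
        & trace3 P \is a Num.int] & T P = 0].
Proof. by []. Qed.

Lemma T_alpha P : T (alpha P) = T P.
Proof. by have [x y z] := trace_alpha P; rewrite !T_trace x y z; ring. Qed.

Lemma T_beta P : T (beta P) = T P.
Proof. by have [x y z] := trace_beta P; rewrite !T_trace x y z; ring. Qed.

(** The new entry and the new trace have the form p q - r with p, q kept, so r is recovered by the
    same formula. *)
Lemma divisible_solution_alpha k P :
  divisible_solution k (alpha P) <-> divisible_solution k P.
Proof.
case: P => [[[[a b] c] d] e].
have := T_alpha (a, b, c, d, e); have := trace_alpha (a, b, c, d, e).
have [-> a'E] := alpha_linear a b c d e.
set a' := (alpha _).1.1.1.2 in a'E *.
set P := (a, b, c, d, e) in a'E *; set Q := (b, a', c, d, e).
move=> [xE yE zE] TE; rewrite !divisible_solutionE.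
rewrite -/P -/Q TE xE yE zE a'E mulrBl -mulrA.
split=> -[-> [ka kb kc kd] [kx ky kz] ->]; split=> //; split=> //.
- by rewrite -[X in X \is a _](subKr (trace1 P * (b%:num / k%:num)));
    apply: rpredB kb; apply: rpredM.
- by rewrite -[X in X \is a _](subKr (trace1 P * trace3 P));
    apply: rpredB kz; apply: rpredM.
- by apply: rpredB ka; apply: rpredM.
- by apply: rpredB ky; apply: rpredM.
Qed.

(** Only [d] is dropped by [beta], and the first of [trace_relations] recovers it. *)
Lemma divisible_solution_beta k P :
  divisible_solution k (beta P) <-> divisible_solution k P.
Proof.
case: P => [[[[a b] c] d] e].
have := T_beta (a, b, c, d, e); have := trace_beta (a, b, c, d, e).
have [dE _] := trace_relations a b c d e.
have [-> fE] := beta_linear a b c d e.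
set f := (beta _).1.1.2 in fE *.
set P := (a, b, c, d, e) in fE dE *; set Q := (b, c, f, a, e).
move=> [xE yE zE] TE; rewrite !divisible_solutionE.
rewrite -/P -/Q TE xE yE zE fE.
have {}dE : d%:num / k%:num = trace3 P * (a%:num / k%:num) + c%:num / k%:num
    - trace2 P * (b%:num / k%:num).
  by rewrite (mulrA (trace3 P)) (mulrA (trace2 P)) -mulrDl dE -mulrBl
    addrAC subrr add0r.
rewrite dE mulrDl mulrBl -(mulrA (trace1 P)) -(mulrA (trace3 P)).
split=> -[-> [ka kb kc kd] [kx ky kz] ->]; split=> //; split=> //.
- by apply: rpredB; [apply: rpredD|]; by [|apply: rpredM].
- by apply: rpredD; [apply: rpredB|]; by [|apply: rpredM].
Qed.

(** Having an equivalence lets the induction pass to inverses. *)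
Lemma divisible_solution_G k f P :
  G f -> divisible_solution k (f P) <-> divisible_solution k P.
Proof.
move=> Gf.
elim: Gf P => {f} [f [] -> P|//|f g _ IHf _ IHg P|f g _ IHf fK gK P].
- exact: divisible_solution_alpha.
- exact: divisible_solution_beta.
- by rewrite /= IHf.
- by rewrite -IHf gK.
Qed.

(** * Moves along an orbit and reduced trace triples *)

Lemma orbit_preimage x f P : G f -> orbit_set G x (f P) -> orbit_set G x P.
Proof.
move=> Gf [g Gg gx]; have [h fK hK] := G_bij Gf.
exists (h \o g); last by rewrite /= gx fK.
by apply: generated_comp => //; apply: generated_inv Gf fK hK.
Qed.

Lemma orbit_image x f P : G f -> orbit_set G x P -> orbit_set G x (f P).
Proof.
by move=> Gf [g Gg gx]; exists (f \o g); [exact: generated_comp|rewrite /= gx].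
Qed.

Lemma G_alpha : G alpha. Proof. by apply: generated_mem; left. Qed.
Lemma G_beta : G beta. Proof. by apply: generated_mem; right. Qed.

(* The quadratic [t^2 - x y t + x^2 + y^2 + 7] decreases on [y, x y / 2] and
   vanishes at [z], so it is nonnegative at [y]: this is [key]. *)
Lemma trace_equation_reduced (x y z : nat) :
  (x ^ 2 + y ^ 2 + z ^ 2 + 7 = x * y * z)%N -> (x <= y <= z)%N ->
  (2 * z <= x * y)%N -> [/\ x = 3, y = 4 & z = 4]%N.
Proof.
rewrite -!mulnn => eqn /andP[xy yz] zxy.
have x3 : (3 <= x)%N by case: x eqn xy zxy => [|[|[|x]]] //; nia.
have key : ((x - 2) * (y * y) <= x * x + 7)%N.
  have : (0 <= (z%:Z - y%:Z) * (x%:Z * y%:Z - z%:Z - y%:Z))%R.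
    by apply: mulr_ge0; nia.
  nia.
(* With x <= y, [key] gives (x - 3) x^2 <= 7, false from x = 4 on; at x = 3 it reads y^2 <= 16. *)
have xlt4 : (x < 4)%N by nia.
have {xlt4}x3 : x = 3%N by lia.
subst x.
have y4 : (y <= 4)%N by nia.
have z6 : (z <= 6)%N by lia.
by move: y z y4 z6 eqn xy yz zxy {key} => [|[|[|[|[|y]]]]] [|[|[|[|[|[|[|z]]]]]]].
Qed.

(** * Descent in the fibre over (3, 4, 4) *)

Lemma beta3_fiber (a b c d e : Qpos) (P := (a, b, c, d, e) : Qpos5) :
  trace1 P = 3 -> trace2 P = 4 -> trace3 P = 4 ->
  exists a' b' c' : Qpos, beta (beta (beta P)) = (a', b', c', c, e) /\
    c'%:num = 9 * c%:num - d%:num - 3 * e%:num.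
Proof.
rewrite /P => x y z.
have [] := trace_relations a b c d e; rewrite x y z => dE eE.
have [] := trace_beta (a, b, c, d, e); rewrite x y z.
have [] := beta_linear a b c d e; rewrite x z.
move: ((beta _).1.1.2) => f -> fE x1 y1 z1.
have [] := trace_beta (b, c, f, a, e); rewrite x1 y1 z1.
have [] := beta_linear b c f a e; rewrite x1 z1.
move: ((beta _).1.1.2) => g -> gE x2 y2 z2.
have [] := beta_linear c f g b e; rewrite x2 z2.
move: ((beta _).1.1.2) => h -> hE.
by exists f, g, h; split=> //; lra.
Qed.

Lemma trace_beta3 P : [/\ trace1 (beta (beta (beta P))) = trace1 P,
  trace2 (beta (beta (beta P))) = trace2 P &
  trace3 (beta (beta (beta P))) = trace3 P].
Proof.
have [x1 y1 z1] := trace_beta P; have [x2 y2 z2] := trace_beta (beta P).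
by have [-> -> ->] := trace_beta (beta (beta P)); rewrite x2 y2 z2 x1 y1 z1.
Qed.

Lemma Qpos_divides (x k : Qpos) : x%:num / k%:num \is a Num.int ->
  exists2 n : nat, (0 < n)%N & x%:num = n%:R * k%:num.
Proof.
move=> xk; have /natrP[n xn] : x%:num / k%:num \is a Num.nat.
  by rewrite natrEint xk /= divr_ge0.
exists n; last by rewrite -xn divfK.
have : 0 < x%:num / k%:num by rewrite divr_gt0.
by rewrite xn ltr0n.
Qed.

(** The linear relations give 4 m = u + 2 v + 1 and 4 n = 2 u + v + 1; substituted in m^2 + n^2 + u
    v = 3 m n, which is [trace1 P = 3], they leave the quadratic in [u], [v]. *)
Lemma fiber_equation k a b c d (P := (a, b, c, d, k) : Qpos5) :
  divisible_solution k P ->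
  trace1 P = 3 -> trace2 P = 4 -> trace3 P = 4 ->
  exists m n u v : nat,
    [/\ a%:num = m%:R * k%:num, b%:num = n%:R * k%:num,
        c%:num = u%:R * k%:num & d%:num = v%:R * k%:num] /\
    [/\ (4 * m + u = 4 * n + v)%N, (4 * n = v + 1 + 2 * u)%N &
        (u * u + v * v + 3 * (u + v) + 1 = 9 * (u * v))%N].
Proof.
rewrite /P => -[_ [ka kb kc kd] _ _] x y z.
have [] := trace_relations a b c d k; rewrite x y z => dE eE.
have quad : a%:num ^+ 2 + b%:num ^+ 2 + c%:num * d%:num = 3 * a%:num * b%:num.
  by rewrite -x /trace1 /=; field; rewrite ?gt_eqF.
have [m _ aE] := Qpos_divides ka; have [n _ bE] := Qpos_divides kb.
have [u _ cE] := Qpos_divides kc; have [v _ dE'] := Qpos_divides kd.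
exists m, n, u, v; split=> //.
have k0 : k%:num != 0 by [].
have e1 : (4 * m + u = 4 * n + v)%N.
  apply/eqP; rewrite -(eqr_nat rat) !(natrM, natrD); apply/eqP/(mulIf k0).
  by move: dE; rewrite aE bE cE dE'; lra.
have e2 : (4 * n = v + 1 + 2 * u)%N.
  apply/eqP; rewrite -(eqr_nat rat) !(natrM, natrD); apply/eqP/(mulIf k0).
  by move: dE eE; rewrite aE bE cE dE'; lra.
have e3 : (m * m + n * n + u * v = 3 * (m * n))%N.
  apply/eqP; rewrite -(eqr_nat rat) !(natrM, natrD); apply/eqP/(mulIf k0)/(mulIf k0).
  by move: quad; rewrite aE bE cE dE'; lra.
by split=> //; nia.
Qed.

(* The Vieta partner [9 u - v - 3] of the root [v] is smaller than [v]. *)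
Lemma fiber_descent (u v : nat) :
  (u * u + v * v + 3 * (u + v) + 1 = 9 * (u * v))%N -> (u + 4 <= v)%N ->
  (9 * u <= 2 * v + 2)%N.
Proof.
(* If 9 u >= 2 v + 3, the equation yields v^2 <= u^2 + 3 u + 1, against v >= u + 4. *)
move=> eqn uv; rewrite leqNgt; apply/negP => big.
have : ((2 * v + 3) * v <= 9 * u * v)%N by rewrite leq_mul2r; lia.
have : ((u + 4) * (u + 4) <= v * v)%N by rewrite leq_mul.
nia.
Qed.

Lemma fiber_orbit k P : divisible_solution k P ->
  trace1 P = 3 -> trace2 P = 4 -> trace3 P = 4 ->
  orbit_set G (k, k, k, k, k) P.
Proof.
(* Induction on an integer bound for (c + d) / k. *)
have [n] : exists n : nat, P.1.1.2%:num + P.1.2%:num <= n%:R * k%:num.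
  exists (Num.bound ((P.1.1.2%:num + P.1.2%:num) / k%:num)).
  by rewrite -ler_pdivrMr // ltW // archi_boundP // divr_ge0.
elim: n P => [|n IH] [[[[a b] c] d] e] /= cdn solP.
  by have : 0 < c%:num + d%:num by []; rewrite ltNge (le_trans cdn) ?mul0r.
have ek : e = k by case: solP.
subst e => x y z.
have [m [l [u [v [[aE bE cE dE] [e1 e2 eqn]]]]]] := fiber_equation solP x y z.
have uvn : (u + v <= n.+1)%N.
  by rewrite -(ler_nat rat) natrD -(ler_pM2r (gt0 k)) mulrDl -cE -dE.
have [uv|uv|uv] := ltngtP u v.
(* [e1] forces u = v mod 4, hence the gap of 4 that [fiber_descent] requires; after the jump the two
   entries sum to at most [n] in units of [k]. *)
- have small : (9 * u + u <= n + v + 3)%N by have := fiber_descent eqn; lia.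
  have [a' [b' [c' [QE c'E]]]] := beta3_fiber x y z.
  do 3![apply: (orbit_preimage G_beta)]; rewrite QE.
  have [x3 y3 z3] := trace_beta3 (a, b, c, d, k).
  rewrite QE x y z in x3 y3 z3.
  apply: IH => //.
  + rewrite /= c'E cE dE.
    by move: small; rewrite -(ler_nat rat) !(natrM, natrD) -(ler_pM2r (gt0 k)); lra.
  + by rewrite -QE !divisible_solution_beta.
(* Symmetrically, the inverse of the triple [beta] performs the jump (c, d) -> (d, 9 d - c - 3
   k). *)
- have small : (9 * v + v <= n + u + 3)%N by have := @fiber_descent v u; lia.
  have [Q QP] : exists Q, beta (beta (beta Q)) = (a, b, c, d, k).
    have [g _ gK] := beta_bij; exists (g (g (g (a, b, c, d, k)))).
    by rewrite !gK.
  have [] := trace_beta3 Q; rewrite QP x y z => xQ yQ zQ.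
  rewrite -QP; do 3![apply: (orbit_image G_beta)].
  have solQ : divisible_solution k Q.
    by do 3![apply: (divisible_solution_beta _ _).1]; rewrite QP.
  apply: IH => //; clear solP solQ.
  case: Q => [[[[a0 b0] c0] d0] e0] in QP xQ yQ zQ *.
  have [a' [b' [c' [QE c'E]]]] := beta3_fiber (esym xQ) (esym yQ) (esym zQ).
  move: QP; rewrite QE => -[_ _ cc dd ek] /=.
  move: c'E; rewrite cc dd ek cE dE => c'E.
  by move: small; rewrite -(ler_nat rat) !(natrM, natrD) -(ler_pM2r (gt0 k)); lra.
(* For u = v the equation becomes 7 u^2 - 6 u - 1 = 0. *)
- have u1 : u = 1%N by rewrite -uv in eqn; clear -eqn; nia.
  have [l1 m1] : l = 1%N /\ m = 1%N by lia.
  rewrite l1 m1 -uv u1 !mul1r in aE bE cE dE.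
  exists idfun; first exact: generated_id.
  by congr (_, _, _, _, _); apply/val_inj; rewrite /= ?(aE, bE, cE, dE).
Qed.

(** * Descent on the sum of the traces *)

Lemma trace_equation k P : divisible_solution k P ->
  exists x y z : nat,
    [/\ trace1 P = x%:R, trace2 P = y%:R & trace3 P = z%:R] /\
    (x ^ 2 + y ^ 2 + z ^ 2 + 7 = x * y * z)%N.
Proof.
move=> solP.
have [xP yP zP TP] : [/\ trace1 P \is a Num.nat, trace2 P \is a Num.nat,
    trace3 P \is a Num.nat & T P = 0].
  by case: P solP => [[[[a b] c] d] e] [_ _ [? ? ?] ?];
    split=> //; rewrite natrEint; apply/andP; split=> //;
    rewrite /trace1 /trace2 /trace3.
have /natrP[x xE] := xP; have /natrP[y yE] := yP; have /natrP[z zE] := zP.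
exists x, y, z; split=> //.
apply/eqP; rewrite -(eqr_nat rat) !(natrM, natrD, natrX) eq_sym -subr_eq0.
by rewrite -xE -yE -zE -TP T_trace; apply/eqP; ring.
Qed.

Lemma divisible_solution_orbit k P :
  divisible_solution k P -> orbit_set G (k, k, k, k, k) P.
Proof.
move=> solP; have [x [y [z [[xE yE zE] eqn]]]] := trace_equation solP.
have [n] := ubnP (x + y + z).
elim: n P x y z solP xE yE zE eqn => // n IH.
(* The inverse of [alpha] replaces the third trace z by its Vieta partner x y - z; the cases with x
   or y largest are rotated to this one by [beta]. *)
have zmax P (x y z : nat) : divisible_solution k P -> trace1 P = x%:R ->
    trace2 P = y%:R -> trace3 P = z%:R ->
    (x ^ 2 + y ^ 2 + z ^ 2 + 7 = x * y * z)%N -> (x + y + z < n.+1)%N ->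
    (x <= z)%N -> (y <= z)%N -> orbit_set G (k, k, k, k, k) P.
  move=> solP xE yE zE eqn xyzn xz yz.
  have [red|lt_xy] := leqP (2 * z) (x * y).
    have [xy|/ltnW yx] := leqP x y.
      have xyz : (x <= y <= z)%N by rewrite xy.
      have [x3 y4 z4] := trace_equation_reduced eqn xyz red.
      by subst x y z; apply: fiber_orbit.
    have yxz : (y <= x <= z)%N by rewrite yx.
    rewrite (addnC (x ^ 2)%N) (mulnC x) in eqn red.
    have [y3 x4 z4] := trace_equation_reduced eqn yxz red.
    (* The traces are (4, 3, 4), and one [beta] turns them into (3, 4, 4). *)
    subst x y z; have [xb yb zb] := trace_beta P.
    apply: (orbit_preimage G_beta); apply: fiber_orbit; rewrite ?xb ?yb ?zb //.
    exact/divisible_solution_beta.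
  (* Since z^2 < x y z, the truncated difference x y - z below is exact. *)
  have z_le : (z <= x * y)%N by move: eqn; rewrite -!mulnn; nia.
  have [Q QP] : exists Q, alpha Q = P.
    by have [g _ gK] := alpha_bij; exists (g P).
  have [xQ yQ zQ] := trace_alpha Q.
  rewrite QP xE yE zE in xQ yQ zQ.
  rewrite -QP; apply: (orbit_image G_alpha).
  apply: (IH Q x (x * y - z)%N y) => //.
  - by apply: (divisible_solution_alpha _ _).1; rewrite QP.
  - by rewrite natrB // natrM zQ -xQ -yQ subKr.
  - have [w wE] : exists w, (x * y = z + w)%N by exists (x * y - z)%N; lia.
    by rewrite wE; move: eqn; rewrite wE -!mulnn; nia.
  - by lia.
move=> P x y z solP xE yE zE eqn xyzn.
have [x1 y1 z1] := trace_beta P; have [x2 y2 z2] := trace_beta (beta P).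
have sol1 := (divisible_solution_beta _ _).2 solP.
have sol2 := (divisible_solution_beta _ _).2 sol1.
have xmax : (y <= x)%N -> (z <= x)%N -> orbit_set G (k, k, k, k, k) P.
  move=> yx zx; apply: (orbit_preimage G_beta).
  by apply: (zmax _ y z x); rewrite ?x1 ?y1 ?z1 //; lia.
have ymax : (x <= y)%N -> (z <= y)%N -> orbit_set G (k, k, k, k, k) P.
  move=> xy zy; apply/(orbit_preimage G_beta)/(orbit_preimage G_beta).
  by apply: (zmax _ z x y); rewrite ?x2 ?y2 ?z2 ?x1 ?y1 ?z1 //; lia.
have [xz|/ltnW zx] := leqP x z; have [yz|/ltnW zy] := leqP y z.
- exact: (zmax P x y z).
- exact: ymax (leq_trans xz zy) zy.
- exact: xmax (leq_trans yz zx) zx.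
- by have [/ymax|/ltnW/xmax] := leqP x y; apply.
Qed.

(** * Passage between rational and positive integer points *)

Lemma Qpos_int_natQ (x : Qpos) : x%:num \is a Num.int -> exists n, x = natQ n.
Proof.
move=> xint; have /natrP[n nE] : x%:num \is a Num.nat by rewrite natrEint xint /=.
have n0 : (0 < n)%N by rewrite -(ltr0n rat) -nE.
by exists (exist _ n n0); apply/val_inj.
Qed.

Theorem theorem5p2 (eps : Npos) :
  orbit_set G (vecQ eps eps eps eps eps)
  = [set P : Qpos5 | exists a b c d : Npos,
      [/\ P = vecQ a b c d eps,
          T P = 0,
          N3 (phi P) &
          vec_dvd eps a b c d eps]].
Proof.
have eps0 : (val eps)%:R != 0 :> rat by rewrite gt_eqF ?natQ_gt0.
apply/seteqP; split=> P.
- move=> [f Gf <-].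
  (* The base point lies over (3, 4, 4); invariance spreads its properties over the orbit. *)
  have sol1 : divisible_solution (natQ eps) (vecQ eps eps eps eps eps).
    split=> //=; rewrite ?divff //.
    + have [] : [/\ trace1 (vecQ eps eps eps eps eps) = 3,
        trace2 (vecQ eps eps eps eps eps) = 4 &
        trace3 (vecQ eps eps eps eps eps) = 4].
        by rewrite /trace1 /trace2 /trace3 /=; split; field.
      by rewrite /vecQ => -> -> ->.
    + by field.
  have := (divisible_solution_G (natQ eps) _ Gf).2 sol1.
  case: (f _) => [[[[a b] c] d] e] [-> [ka kb kc kd]].
  have toN (x : Qpos) : x%:num / (natQ eps)%:num \is a Num.int ->
      exists2 m : Npos, x = natQ m & (val eps %| val m)%N.
    move=> /Qpos_divides[n n0 xE].
    have m0 : (0 < n * val eps)%N by rewrite muln_gt0 n0 (valP eps).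
    exists (exist _ (n * val eps)%N m0); last by rewrite /= dvdn_mull.
    by apply/val_inj; rewrite /= natrM.
  have [m -> dm] := toN _ ka; have [n -> dn] := toN _ kb.
  have [p -> dp] := toN _ kc; have [q -> dq] := toN _ kd.
  move=> [kx ky kz] T0; exists m, n, p, q; split=> //;
    last by rewrite /vec_dvd dm dn dp dq dvdnn.
  have [x xE] := Qpos_int_natQ kx; have [y yE] := Qpos_int_natQ ky.
  have [z zE] := Qpos_int_natQ kz.
  exists x, y, z; rewrite -xE -yE -zE.
  by case: (phi _) => [[]].
- move=> [a [b [c [d [-> T0 [x [y [z xyz]]] /and5P[ka kb kc kd _]]]]]].
  apply: divisible_solution_orbit; split=> //.
  + have div (n : Npos) : (val eps %| val n)%N ->
        (natQ n)%:num / (natQ eps)%:num \is a Num.int.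
      move=> /dvdnP[m nE]; rewrite /= nE natrM mulfK //.
    by split; apply: div.
  + by rewrite /trace1 /trace2 /trace3 -/(vecQ a b c d eps) xyz;
    split; rewrite /= natr_int.
Qed.
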